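(* Let $n,N\in\mathbb{N}$, $s\in(0,1)$, $p\in(1,\infty)$, and let $\Omega\subset\mathbb{R}^n$ be a bounded domain. Suppose ${\bf u}\in W^{s,p}_0(\Omega;\mathbb{R}^N)$ is a vector minimizer for $\Lambda^N_s$, i.e. ${\bf u}\not\equiv 0$ and the infimum defining $\Lambda^N_s$ is attained at ${\bf u}$. Then there are a vector ${\bf c}\in\mathbb{R}^N\setminus\{0\}$ and a scalar minimizer $\omega\in W^{s,p}_0(\Omega;\mathbb{R})$ for $\Lambda^1_s$ (i.e. $\omega\not\equiv0$ and the infimum defining $\Lambda^1_s$ is attained at $\omega$) such that ${\bf u}={\bf c}\,\omega$ (almost everywhere).
   Context: For $N\in\mathbb{N}$, $$\Lambda^N_s=\inf_{{\bf v}}\frac{\displaystyle\int_{\mathbb{R}^n}\int_{\mathbb{R}^n}\frac{|{\bf v}(x)-{\bf v}(y)|^p}{|x-y|^{n+sp}}\,dx\,dy}{\displaystyle\int_\Omega|{\bf v}|^p\,dx},$$ where the infimum is over all ${\bf v}=(v_1,\ldots,v_N)\in W^{s,p}_0(\Omega;\mathbb{R}^N)$ that are not identically $0$, and $|\cdot|$ is the Euclidean norm. Here $W^{s,p}_0(\Omega;\mathbb{R}^N)$ is the fractional Sobolev space given by the closure of $C_c^\infty(\Omega;\mathbb{R}^N)$ (functions extended by zero) in the norm $\left(\int_{\mathbb{R}^n}|{\bf v}|^p\,dx+\int_{\mathbb{R}^n}\int_{\mathbb{R}^n}\frac{|{\bf v}(x)-{\bf v}(y)|^p}{|x-y|^{n+sp}}\,dx\,dy\right)^{1/p}$;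 its elements are functions on $\mathbb{R}^n$ with ${\bf v}=0$ in $\mathbb{R}^n\setminus\Omega$. The infimum is attained for every $N$. *)

(* Defs.v *)
From HB Require Import structures.
From mathcomp Require Import all_boot all_order all_algebra.
From mathcomp Require Import all_classical all_reals all_analysis.
Set Implicit Arguments.
Unset Strict Implicit.
Unset Printing Implicit Defensive.
Import Order.TTheory GRing.Theory Num.Theory.
Import numFieldNormedType.Exports.

Local Open Scope classical_set_scope.
Local Open Scope ring_scope.

Definition measure_rV_display : measure_display.
Proof. exact. Qed.

(* 'rV[R]_n carries the product sigma-algebra, which coincides with the Borel
   sets of its topology *)
Section measurable_rV.
Variables (R : realType) (n : nat).

Let coord (i : 'I_n) (x : 'rV[R]_n) : measurableTypeR R := x ord0 i.

Let rV_set0 : g_sigma_preimage coord set0.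
Proof. exact: sigma_algebra0. Qed.

Let rV_setC A : g_sigma_preimage coord A -> g_sigma_preimage coord (~` A).
Proof. exact: sigma_algebraC. Qed.

Let rV_bigcup (F : _^nat) : (forall i, g_sigma_preimage coord (F i)) ->
  g_sigma_preimage coord (\bigcup_i (F i)).
Proof. exact: sigma_algebra_bigcup. Qed.

HB.instance Definition _ := @isMeasurable.Build measure_rV_display
  'rV[R]_n (g_sigma_preimage coord) rV_set0 rV_setC rV_bigcup.

End measurable_rV.

Section measurable_rV_lemmas.
Variables (R : realType) (n : nat).

Lemma measurable_rV_coord (i : 'I_n) :
  measurable_fun [set: 'rV[R]_n] (fun x => x ord0 i : measurableTypeR R).
Proof.
move=> _ Y mY; rewrite setTI; apply: sub_sigma_algebra => /=.
rewrite -bigcup_seq/=; exists i => /=; first by rewrite mem_index_enum.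
by exists Y => //; rewrite setTI.
Qed.

Lemma measurable_fun_rV d (T : measurableType d) (f : T -> 'rV[R]_n) :
  (forall i, measurable_fun [set: T] (fun x => f x ord0 i : measurableTypeR R)) ->
  measurable_fun [set: T] f.
Proof.
move=> mf _ A mA; rewrite setTI.
suff : image_set_system setT f measurable A by rewrite /image_set_system/= setTI.
apply: mA; split; first exact/sigma_algebra_image/sigma_algebra_measurable.
move=> B; rewrite -bigcup_seq/= => -[i _ [Y mY <-]].
rewrite /image_set_system/= !setTI.
have := mf i measurableT Y mY.
by rewrite setTI.
Qed.

Definition cons_rV (p : measurableTypeR R * 'rV[R]_n) : 'rV[R]_n.+1 :=
  row_mx (p.1)%:M p.2.

Lemma cons_rV0 p : cons_rV p ord0 ord0 = p.1.
Proof.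
rewrite /cons_rV (_ : ord0 = lshift n (ord0 : 'I_1)); last exact/val_inj.
by apply: etrans (row_mxEl _ _ _ _) _; rewrite mxE eqxx mulr1n.
Qed.

Lemma cons_rVS p i : cons_rV p ord0 (lift ord0 i) = p.2 ord0 i.
Proof.
rewrite /cons_rV (_ : lift ord0 i = rshift 1 i); last exact/val_inj.
exact: row_mxEr.
Qed.

End measurable_rV_lemmas.

Lemma measurable_cons_rV (R : realType) n : measurable_fun setT (@cons_rV R n).
Proof.
apply: measurable_fun_rV => i; case: (unliftP ord0 i) => [j ->|->].
  under eq_fun do rewrite cons_rVS.
  exact: (measurableT_comp (@measurable_rV_coord R n j) measurable_snd).
under eq_fun do rewrite cons_rV0.
exact: measurable_fst.
Qed.

Section lebesgue_rVS.
Variables (R : realType) (n : nat).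
Variable mu : {sigma_finite_measure set 'rV[R]_n -> \bar R}.

Definition lebesgue_rVS : set 'rV[R]_n.+1 -> \bar R :=
  pushforward (@lebesgue_measure R \x mu)%E (@cons_rV R n).

Let lebesgue_rVS0 : lebesgue_rVS set0 = 0%E.
Proof. by rewrite /lebesgue_rVS /pushforward preimage_set0 measure0. Qed.

Let lebesgue_rVS_ge0 A : (0 <= lebesgue_rVS A)%E.
Proof.
rewrite /lebesgue_rVS /pushforward; exact: measure_ge0.
Qed.

Let lebesgue_rVS_sigma_additive : semi_sigma_additive lebesgue_rVS.
Proof.
have := @measure_semi_sigma_additive _ _ _
  (measure_function_pushforward__canonical__measure_function_Measure
    (@lebesgue_measure R \x mu)%E (@measurable_cons_rV R n)).
exact.
Qed.

HB.instance Definition _ := isMeasure.Build _ _ _ lebesgue_rVS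
  lebesgue_rVS0 lebesgue_rVS_ge0 lebesgue_rVS_sigma_additive.

Let lebesgue_rVS_sigma_finite : sigma_finite setT lebesgue_rVS.
Proof.
have [F TF Foo] : sigma_finite setT (@lebesgue_measure R \x mu)%E.
  have /sigma_finiteP[F [TF ndF Foo]] := sigma_finiteT (@lebesgue_measure R).
  have /sigma_finiteP[G [TG ndG Goo]] := sigma_finiteT mu.
  exists (fun k => F k `*` G k).
    rewrite -setXTT TF TG predeqE => -[x y]; split.
      move=> [/= [k _ Fkx] [l _ Gly]]; exists (maxn k l) => //; split.
      - by move: x Fkx; exact/subsetPset/ndF/leq_maxl.
      - by move: y Gly; exact/subsetPset/ndG/leq_maxr.
    by move=> [k _ []/= ? ?]; split; exists k.
  move=> k; have [? ?] := Foo k; have [? ?] := Goo k.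
  split; first exact: measurableX.
  by rewrite product_measure1E// lte_mul_pinfty// ge0_fin_numE.
pose uncons (v : 'rV[R]_n.+1) : measurableTypeR R * 'rV[R]_n :=
  (v ord0 ord0, \row_i v ord0 (lift ord0 i)).
have unconsK : cancel uncons (@cons_rV R n).
  move=> v; apply/rowP => i; case: (unliftP ord0 i) => [j ->|->].
    by rewrite cons_rVS mxE.
  by rewrite cons_rV0.
have consK : cancel (@cons_rV R n) uncons.
  move=> [a v]; congr pair; first exact: cons_rV0.
  by apply/rowP => i; rewrite mxE cons_rVS.
have muncons : measurable_fun setT uncons.
  apply/measurable_fun_pairP; split; first exact: measurable_rV_coord.
  apply: measurable_fun_rV => i.
  rewrite [X in measurable_fun _ X]
      (_ : _ = fun v : 'rV[R]_n.+1 => v ord0 (lift ord0 i)).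
    exact: measurable_rV_coord.
  by apply/funext => v /=; rewrite mxE.
exists (fun k => uncons @^-1` F k).
  by rewrite -preimage_bigcup -TF preimage_setT.
move=> k; have [mF Fk] := Foo k; split.
  by rewrite -[X in measurable X]setTI; exact: muncons.
rewrite /lebesgue_rVS /pushforward -comp_preimage.
by rewrite (_ : uncons \o _ = id)//; apply/funext => x /=; rewrite consK.
Qed.

HB.instance Definition _ := Measure_isSigmaFinite.Build _ _ _ lebesgue_rVS
  lebesgue_rVS_sigma_finite.

End lebesgue_rVS.

(* 'rV[R]_0 is a single point, of Lebesgue measure 1 *)
Fixpoint lebesgue_rV (R : realType) (n : nat) :
    {sigma_finite_measure set 'rV[R]_n -> \bar R} :=
  match n with
  | 0%N => \d_(0 : 'rV[R]_0)
  | m.+1 => lebesgue_rVS (lebesgue_rV R m)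
  end.

Lemma lebesgue_rV_box (R : realType) (n : nat) (A : 'I_n -> set R) :
  (forall i, measurable (A i)) ->
  lebesgue_rV R n [set x | forall i, A i (x ord0 i)] =
  (\prod_(i < n) lebesgue_measure (A i))%E.
Proof.
elim: n A => [A _|n IH A mA].
  by rewrite big_ord0 /= diracE mem_set//= => -[].
rewrite big_ord_recl /= /lebesgue_rVS /pushforward.
set B := [set x : 'rV[R]_n | forall i, A (lift ord0 i) (x ord0 i)].
have mB : measurable B.
  have -> : B = \bigcap_(i in [set: 'I_n])
      (fun x : 'rV[R]_n => x ord0 i : measurableTypeR R) @^-1` A (lift ord0 i).
    by apply/seteqP; split => [x h i _|x h i]; [exact: h|exact: (h i)].
  apply: fin_bigcap_measurable => // i _.
  rewrite -[X in measurable X]setTI.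
  exact: (@measurable_rV_coord R n i measurableT _ (mA _)).
rewrite (_ : _ @^-1` _ = A ord0 `*` B).
  rewrite product_measure1E//; last exact: mA.
  by rewrite -(IH (fun i => A (lift ord0 i)))// => i; exact: mA.
apply/seteqP; split => [[a x]/= h|[a x] [/= Aa Bx] i].
  split => [|i]; first by have := h ord0; rewrite cons_rV0.
  by have := h (lift ord0 i); rewrite cons_rVS.
by case: (unliftP ord0 i) => [j ->|->]; rewrite ?cons_rVS ?cons_rV0//; exact: Bx.
Qed.

Definition enorm (R : realType) (n : nat) (x : 'rV[R]_n) : R :=
  Num.sqrt (\sum_(i < n) x ord0 i ^+ 2).

Fixpoint Ck (R : realType) (n N k : nat) (f : 'rV[R]_n -> 'rV[R]_N) : Prop :=
  match k with
  | 0%N => continuous f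
  | j.+1 => (forall x, differentiable f x) /\
            (forall v, Ck j (fun x => 'D_v f x))
  end.

Definition smooth (R : realType) (n N : nat) (f : 'rV[R]_n -> 'rV[R]_N) :=
  forall k, Ck k f.

Section fractional_sobolev.
Variables (R : realType) (n N : nat) (s p : R) (Omega : set 'rV[R]_n).
Implicit Types v phi : 'rV[R]_n -> 'rV[R]_N.

Local Notation leb := (lebesgue_rV R n).

(* elements of C_c^oo(Omega; R^N), extended by 0 to R^n *)
Definition test_function phi :=
  [/\ smooth phi,
      compact (closure [set x | phi x != 0]) &
      closure [set x | phi x != 0] `<=` Omega].

(* at x = y the integrand is 0 / 0 = 0, by the conventions 0 `^ r = 0 for
   r != 0 and 0^-1 = 0 *)
Definition gagliardo v : \bar R :=
  (\int[leb]_x \int[leb]_y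
     (enorm (v x - v y) `^ p / enorm (x - y) `^ (n%:R + s * p))%:E)%E.

Definition sobolev_norm v : \bar R :=
  ((\int[leb]_x (enorm (v x) `^ p)%:E + gagliardo v) `^ p^-1)%E.

(* W^{s,p}(R^n; R^N), through representatives *)
Definition sobolev v :=
  measurable_fun [set: 'rV[R]_n] v /\ (sobolev_norm v < +oo)%E.

(* closure of C_c^oo(Omega; R^N) in W^{s,p}(R^n; R^N); being closed under a.e.
   modification, it contains functions vanishing outside Omega only a.e. *)
Definition sobolev0 v :=
  sobolev v /\
  forall e : R, 0 < e -> exists phi,
    test_function phi /\ (sobolev_norm (fun x => v x - phi x)%R < e%:E)%E.

Definition nontrivial v := ~ {ae leb, forall x, v x = 0}.

Definition rayleigh v : \bar R :=
  (gagliardo v / \int[leb]_(x in Omega) (enorm (v x) `^ p)%:E)%E.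

Definition Lambda : \bar R :=
  ereal_inf [set rayleigh v | v in [set v | sobolev0 v /\ nontrivial v]].

Definition minimizer v :=
  [/\ sobolev0 v, nontrivial v & rayleigh v = Lambda].

End fractional_sobolev.

Definition bounded_domain (R : realType) (n : nat) (Omega : set 'rV[R]_n) :=
  [/\ Omega !=set0, open Omega, connected Omega & bounded_set Omega].

(* Main.v *)
Require Import Defs.
From mathcomp Require Import all_boot all_order all_algebra.
From mathcomp Require Import all_classical all_reals all_analysis.
From mathcomp Require Import measurable_realfun.
From mathcomp Require Import ring lra.
Import Order.TTheory GRing.Theory Num.Theory.
Import numFieldNormedType.Exports.
Local Open Scope classical_set_scope.
Local Open Scope ring_scope.

Set Implicit Arguments.
Unset Strict Implicit.
Unset Printing Implicit Defensive.

(** The idea is to compare a minimizer [u] with its own length [|u|].  Passing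
    from [u] to [|u|] leaves the denominator unchanged and can only decrease
    the seminorm, since [ ||a| - |b|| <= |a - b| ].  As [|u|], times any fixed
    unit vector, is again a competitor, minimality forces equality in the
    reverse triangle inequality for almost every pair [(u x, u y)], and
    equality there means that [u x] and [u y] lie on a common ray
    ([enormB_dist_parallel]).  Fixing by Fubini one point [x0] with
    [u x0 <> 0] for which this holds with almost every [y] gives
    [u = |u| c] with [c = u x0 / |u x0|] ([minimizer_ae_ray]).

    The delicate point is the claim that [|u|] is an admissible competitor, as
    the space is a closure of smooth functions.  Rather than proving that the
    modulus acts on this closure, the comparison is made along an
    approximation: if test functions [phi_k] tend to [u], then
    [v_k = (sqrt (eps_k ^ 2 + |phi_k| ^ 2) - eps_k) e], with [e] a unit vector,
    is again a test function, because [t |-> sqrt (eps ^ 2 + t ^ 2) - eps] is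
    smooth in [t ^ 2] and vanishes at [0].  It is also 1-Lipschitz in [t], so
    the difference between the seminorm densities of [phi_k] and [v_k], here
    called the defect, is nonnegative, and
    [Lambda |v_k|_p^p + (integral of the defect of phi_k) <= [phi_k]^p].
    The right-hand side tends to [[u]^p = Lambda |u|_p^p] by Minkowski's
    inequality, while Fatou's lemma bounds the left-hand side from below by
    [Lambda |u|_p^p] plus the integral of the defect of [u].  Hence the latter
    vanishes ([minimizer_defect_eq0]), without having to decide to which space
    [|u|] belongs.

    The scalar minimizer is then taken to be the linear function
    [w = u . c], which equals [|u|] almost everywhere: linear maps do preserve
    the closure ([sobolev0_mulmx]), and [u = w c] shows that [w] has the same
    quotient as [u].  It is minimal because scalar competitors embed into
    vector ones through a unit vector ([Lambda_vector_le_scalar]). *)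

(** * Euclidean length and its smooth approximation *)

Section euclidean.
Variables (R : realType) (N : nat).
Implicit Types a b c : 'rV[R]_N.

Definition dotv a b : R := \sum_(i < N) a ord0 i * b ord0 i.

Lemma enorm_ge0 a : 0 <= enorm a.
Proof. exact: sqrtr_ge0. Qed.

Lemma sqr_enorm a : enorm a ^+ 2 = dotv a a.
Proof.
rewrite sqr_sqrtr; first by apply: eq_bigr => i _; rewrite expr2.
by apply: sumr_ge0 => i _; rewrite sqr_ge0.
Qed.

Lemma enorm_eq0 a : enorm a = 0 -> a = 0.
Proof.
move=> a0; have := sqr_enorm a; rewrite a0 expr0n/= => /esym /eqP.
rewrite psumr_eq0; last by move=> i _; rewrite -expr2 sqr_ge0.
move=> /allP h; apply/rowP => i; rewrite mxE.
by have := h i (mem_index_enum i); rewrite mulf_eq0 orbb => /eqP.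
Qed.

Lemma enormZ (t : R) a : enorm (t *: a) = `|t| * enorm a.
Proof.
rewrite /enorm -sqrtr_sqr -sqrtrM ?sqr_ge0// mulr_sumr.
by congr Num.sqrt; apply: eq_bigr => i _; rewrite !mxE exprMn.
Qed.

Lemma enorm0 : enorm (0 : 'rV[R]_N) = 0.
Proof. by rewrite -(scale0r (0 : 'rV[R]_N)) enormZ normr0 mul0r. Qed.

Lemma sqr_enormZBZ (s t : R) a b :
  enorm (s *: a - t *: b) ^+ 2 =
  s ^+ 2 * enorm a ^+ 2 + t ^+ 2 * enorm b ^+ 2 - 2 * (s * t * dotv a b).
Proof.
rewrite !sqr_enorm /dotv !mulr_sumr -big_split/= -sumrB.
by apply: eq_bigr => i _; rewrite !mxE; ring.
Qed.

Lemma sqr_enormB a b :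
  enorm (a - b) ^+ 2 = enorm a ^+ 2 + enorm b ^+ 2 - 2 * dotv a b.
Proof. by have := sqr_enormZBZ 1 1 a b; rewrite !scale1r expr1n !mul1r. Qed.

(** Expanding [ |B a - A b|^2 ] for [A = |a|] and [B = |b|] gives
    [2 A B (A B - a . b)], so that the sign of a square is the
    Cauchy-Schwarz inequality and its vanishing is the case of equality. *)
Lemma cross_enorm a b :
  enorm (enorm b *: a - enorm a *: b) ^+ 2 =
  2 * (enorm a * enorm b) * (enorm a * enorm b - dotv a b).
Proof. by rewrite sqr_enormZBZ; ring. Qed.

Lemma dotv_le a b : dotv a b <= enorm a * enorm b.
Proof.
have [a0|an0] := eqVneq (enorm a) 0.
  rewrite a0 mul0r (enorm_eq0 a0) /dotv big1// => i _.
  by rewrite mxE mul0r.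
have [b0|bn0] := eqVneq (enorm b) 0.
  rewrite b0 mulr0 (enorm_eq0 b0) /dotv big1// => i _.
  by rewrite mxE mulr0.
have ab0 : 0 < 2 * (enorm a * enorm b).
  by rewrite !mulr_gt0// lt_neqAle enorm_ge0 eq_sym ?an0 ?bn0.
by rewrite -subr_ge0 -(pmulr_rge0 _ ab0) -cross_enorm sqr_ge0.
Qed.

Lemma ler_dist_enorm a b : `|enorm a - enorm b| <= enorm (a - b).
Proof.
rewrite -(ler_pXn2r (n := 2))// ?nnegrE ?enorm_ge0//.
by rewrite real_normK ?num_real// sqr_enormB; have := dotv_le a b; lra.
Qed.

Lemma ler_enormB a b : enorm (a - b) <= enorm a + enorm b.
Proof.
rewrite -(ler_pXn2r (n := 2))// ?nnegrE ?addr_ge0 ?enorm_ge0//.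
rewrite sqr_enormB; have := dotv_le (- a) b.
rewrite -scaleN1r enormZ normrN1 mul1r.
rewrite [dotv _ _](_ : _ = - dotv a b); first by lra.
by rewrite /dotv -sumrN; apply: eq_bigr => i _; rewrite !mxE; ring.
Qed.

(** Squaring the hypothesis leaves [a . b = |a| |b|], the case of equality in
    the Cauchy-Schwarz inequality. *)
Lemma enormB_dist_parallel a b : enorm (a - b) = `|enorm a - enorm b| ->
  enorm b *: a = enorm a *: b.
Proof.
move=> h; apply/eqP; rewrite -subr_eq0; apply/eqP/enorm_eq0/eqP.
rewrite -sqrf_eq0 cross_enorm mulf_eq0; apply/orP; right.
have := sqr_enormB a b; rewrite h real_normK ?num_real// => k.
by apply/eqP; lra.
Qed.

(** A smooth replacement for the length, equal to it when [e = 0].  The shift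
    makes it vanish at the origin, so that composing with it does not enlarge
    supports. *)
Definition smooth_enorm (e : R) a : R := Num.sqrt (e ^+ 2 + enorm a ^+ 2) - e.

Lemma smooth_enorm0 e : 0 <= e -> smooth_enorm e 0 = 0.
Proof.
by move=> e0; rewrite /smooth_enorm enorm0 expr0n addr0 sqrtr_sqr ger0_norm// subrr.
Qed.

(** It suffices that [t |-> sqrt (e ^ 2 + t ^ 2)] is 1-Lipschitz, which says
    that the distance from [(e, x)] to the origin varies by at most
    [|x - y|]. *)
Lemma smooth_enorm_dist e a b :
  `|smooth_enorm e a - smooth_enorm e b| <= `|enorm a - enorm b|.
Proof.
rewrite /smooth_enorm.
set x := enorm a; set y := enorm b.
have x0 : 0 <= x by exact: enorm_ge0.
have y0 : 0 <= y by exact: enorm_ge0.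
set X := Num.sqrt (_ + x ^+ 2); set Y := Num.sqrt (_ + y ^+ 2).
have X2 : X ^+ 2 = e ^+ 2 + x ^+ 2 by rewrite sqr_sqrtr// addr_ge0// sqr_ge0.
have Y2 : Y ^+ 2 = e ^+ 2 + y ^+ 2 by rewrite sqr_sqrtr// addr_ge0// sqr_ge0.
(* Cauchy-Schwarz in the plane for [(e, x)] and [(e, y)] *)
have XY : e ^+ 2 + x * y <= X * Y.
  have l0 : 0 <= e ^+ 2 + x * y by rewrite addr_ge0 ?sqr_ge0 ?mulr_ge0.
  have r0 : 0 <= X * Y by rewrite mulr_ge0 ?sqrtr_ge0.
  rewrite -(ler_pXn2r (n := 2))//.
  rewrite exprMn X2 Y2 -subr_ge0.
  rewrite (_ : _ - _ = e ^+ 2 * (x - y) ^+ 2); last by ring.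
  by rewrite mulr_ge0// sqr_ge0.
rewrite -(ler_pXn2r (n := 2))// ?nnegrE//.
rewrite !real_normK ?num_real// -subr_ge0.
rewrite (_ : _ - _ = x ^+ 2 + y ^+ 2 - 2 * (x * y) - X ^+ 2 - Y ^+ 2 + 2 * (X * Y));
  last by ring.
by rewrite X2 Y2; lra.
Qed.

Lemma smooth_enorm_ge0 e a : 0 <= e -> 0 <= smooth_enorm e a.
Proof.
move=> e0; rewrite subr_ge0 -{1}(ger0_norm e0) -sqrtr_sqr ler_sqrt ?lerDl ?sqr_ge0//.
by rewrite addr_ge0 ?sqr_ge0.
Qed.

Lemma smooth_enorm_le e a : 0 <= e -> smooth_enorm e a <= enorm a.
Proof.
move=> e0; have := smooth_enorm_dist e a 0.
by rewrite smooth_enorm0// enorm0 !subr0 !ger0_norm ?enorm_ge0 ?smooth_enorm_ge0.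
Qed.

Lemma smooth_enorm_ge e a : enorm a - e <= smooth_enorm e a.
Proof.
rewrite lerD2r -{1}(ger0_norm (enorm_ge0 a)) -sqrtr_sqr ler_sqrt ?lerDr ?sqr_ge0//.
by rewrite addr_ge0 ?sqr_ge0.
Qed.

End euclidean.

Lemma enorm_rV1 (R : realType) (a : 'rV[R]_1) : enorm a = `|a ord0 ord0|.
Proof. by rewrite /enorm big_ord1 sqrtr_sqr. Qed.

(** * Smooth functions *)

Section smoothness.
Variables (R : realType) (n : nat).
Local Notation V := 'rV[R]_n.

(** The recursion defining [Ck], for an arbitrary normed target: real-valued
    functions are included, and it is for these that products, square roots
    and inverses are available. *)
Fixpoint Cnk (W : normedModType R) (k : nat) (f : V -> W) : Prop :=
  match k with
  | 0%N => continuous f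
  | j.+1 => (forall x, differentiable f x) /\
            (forall v, Cnk j (fun x => 'D_v f x))
  end.

Lemma CkE N k (f : V -> 'rV[R]_N) : Ck k f <-> Cnk k f.
Proof.
by elim: k f => [|k IH] f; [split|split=> -[df Df]; split=> // v; exact/IH/Df].
Qed.

Lemma CnkW (W : normedModType R) k (f : V -> W) : Cnk k.+1 f -> Cnk k f.
Proof.
elim: k f => [f [df _] x|k IH f [df Df]]; first exact: differentiable_continuous.
by split=> // v; exact: IH (Df v).
Qed.

Lemma Cnk_cst (W : normedModType R) k (w : W) : Cnk k (fun _ : V => w).
Proof.
elim: k w => [|k IH] w; first by move=> x; exact: cst_continuous.
split=> [x|v]; first exact: differentiable_cst.
by under eq_fun do rewrite derive_cst; exact: IH.
Qed.

Lemma CnkD (W : normedModType R) k (f g : V -> W) :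
  Cnk k f -> Cnk k g -> Cnk k (fun x => f x + g x).
Proof.
elim: k f g => [|k IH] f g; first by move=> cf cg x; exact: (cvgD (cf x) (cg x)).
move=> [df Df] [dg Dg]; split=> [x|v]; first exact: differentiableD.
rewrite (_ : (fun x => _) = fun x => 'D_v f x + 'D_v g x).
  exact: IH (Df v) (Dg v).
by apply/funext => x; rewrite deriveD//; exact: diff_derivable.
Qed.

Lemma Cnk_sum (W : normedModType R) k m (f : 'I_m -> V -> W) :
  (forall i, Cnk k (f i)) -> Cnk k (fun x => \sum_(i < m) f i x).
Proof.
elim: m f => [|m IH] f Cf.
  by under eq_fun do rewrite big_ord0; exact: Cnk_cst.
by under eq_fun do rewrite big_ord_recl; apply: CnkD => //; exact: IH.
Qed.

Lemma CnkM k (f g : V -> R) : Cnk k f -> Cnk k g -> Cnk k (fun x => f x * g x).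
Proof.
elim: k f g => [|k IH] f g; first by move=> cf cg x; exact: (cvgM (cf x) (cg x)).
move=> /[dup] Cf [df Df] /[dup] Cg [dg Dg].
split=> [x|v]; first exact: differentiableM.
rewrite (_ : (fun x => _) = fun x => f x * 'D_v g x + g x * 'D_v f x).
  exact: CnkD (IH _ _ (CnkW Cf) (Dg v)) (IH _ _ (CnkW Cg) (Df v)).
apply/funext => x; rewrite (_ : (fun x => f x * g x) = f * g)//.
by rewrite deriveM//; exact: diff_derivable.
Qed.

Lemma CnkZl (W : normedModType R) k (f : V -> R) (w : W) :
  Cnk k f -> Cnk k (fun x => f x *: w).
Proof.
elim: k f => [|k IH] f; first by move=> cf x; exact: cvgZr_tmp (cf x).
move=> [df Df]; split=> [x|v]; first exact: differentiableZl.
rewrite (_ : (fun x => _) = fun x => 'D_v f x *: w); first exact: IH (Df v).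
apply/funext => x; rewrite deriveE; last exact: differentiableZl.
by rewrite diffZl// -deriveE.
Qed.

Lemma Cnk_coord N k (f : V -> 'rV[R]_N) i :
  Cnk k f -> Cnk k (fun x => f x ord0 i).
Proof.
elim: k f => [|k IH] f.
  move=> cf x; apply: (@continuous_comp _ _ _ f (fun M => M ord0 i)).
    exact: cf.
  exact: coord_continuous.
move=> [df Df]; split=> [x|v].
  exact: (differentiable_comp (df x) (differentiable_coord _ _ _)).
rewrite (_ : (fun x => _) = fun x => ('D_v f x) ord0 i); first exact: IH (Df v).
by apply/funext => x; rewrite derive_mx ?mxE//; exact: diff_derivable.
Qed.

Lemma Cnk_mulmx N M k (f : V -> 'rV[R]_N) (A : 'M[R]_(N, M)) :
  Cnk k f -> Cnk k (fun x => f x *m A).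
Proof.
move=> Cf; under eq_fun do rewrite mulmx_sum_row.
by apply: Cnk_sum => i; exact/CnkZl/Cnk_coord.
Qed.

(** With [r = g ^ (-1/2)] the chain rule reads [r' = - r^3 g' / 2], which is
    again a product of [r] and derivatives of [g]; this closes the induction
    on the order. *)
Lemma Cnk_rsqrt k (g : V -> R) : (forall x, 0 < g x) -> Cnk k g ->
  Cnk k (fun x => (Num.sqrt (g x))^-1).
Proof.
move=> g0; have s0 x : Num.sqrt (g x) != 0 by rewrite gt_eqF// sqrtr_gt0.
elim: k => [|k IH].
  move=> cg x; apply: (@cvgV _ _ (nbhs x) _ (Num.sqrt \o g)) => //.
  apply: (@continuous_comp _ _ _ g Num.sqrt); first exact: cg.
  exact: sqrt_continuous.
move=> /[dup] Cg [dg Dg].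
have ds x : differentiable (fun y => Num.sqrt (g y)) x.
  apply: differentiable_comp (dg x) _; apply/derivable1_diffP.
  by have [] := is_derive1_sqrt (g0 x).
split=> [x|v]; first exact: differentiableV.
have Cr := IH (CnkW Cg).
rewrite (_ : (fun x => _) = fun x => - 2^-1 * (Num.sqrt (g x))^-1 *
  (Num.sqrt (g x))^-1 * (Num.sqrt (g x))^-1 * 'D_v g x).
  exact: CnkM (CnkM (CnkM (CnkM (Cnk_cst _ _) Cr) Cr) Cr) (Dg v).
apply/funext => x; rewrite deriveV//; last exact: diff_derivable.
rewrite deriveE// (@diff_comp _ _ _ _ g Num.sqrt)//=; last first.
  by apply/derivable1_diffP; have [] := is_derive1_sqrt (g0 x).
rewrite -(deriveE _ (dg x)) diff1E; last first.
  by apply/derivable1_diffP; have [] := is_derive1_sqrt (g0 x).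
rewrite derive1E derive_sqrt// /GRing.scale/= invfM.
by field.
Qed.

Lemma Cnk_sqrt k (g : V -> R) : (forall x, 0 < g x) -> Cnk k g ->
  Cnk k (fun x => Num.sqrt (g x)).
Proof.
move=> g0 Cg.
rewrite (_ : (fun x => _) = fun x => g x * (Num.sqrt (g x))^-1).
  by apply: CnkM => //; exact: Cnk_rsqrt.
apply/funext => x; apply: (mulIf (x := Num.sqrt (g x))).
  by rewrite gt_eqF// sqrtr_gt0.
by rewrite -mulrA mulVf ?mulr1 ?gt_eqF ?sqrtr_gt0// -expr2 sqr_sqrtr// ltW.
Qed.

Lemma Cnk_smooth_enorm N k (e : R) (f : V -> 'rV[R]_N) : 0 < e ->
  Cnk k f -> Cnk k (fun x => smooth_enorm e (f x)).
Proof.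
move=> e0 Cf; apply: CnkD; last exact: Cnk_cst.
apply: Cnk_sqrt => [x|].
  by rewrite ltr_pwDl ?exprn_gt0 ?sqr_ge0.
apply: CnkD; first exact: Cnk_cst.
under eq_fun do rewrite sqr_enorm.
by apply: Cnk_sum => i; apply: CnkM; exact: Cnk_coord.
Qed.

End smoothness.

Section test_functions.
Variables (R : realType) (n : nat) (Omega : set 'rV[R]_n).

(** Shrinking the support is harmless: the new one is a closed subset of a
    compact subset of the domain. *)
Lemma test_functionS N M (phi : 'rV[R]_n -> 'rV[R]_N) (psi : 'rV[R]_n -> 'rV[R]_M) :
  test_function Omega phi -> smooth psi -> (forall x, phi x = 0 -> psi x = 0) ->
  test_function Omega psi.
Proof.
move=> [_ cphi phiO] spsi phipsi.
have psub : closure [set x | psi x != 0] `<=` closure [set x | phi x != 0].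
  apply: closure_subset => x /=; apply: contra_neq; exact: phipsi.
split=> //; last exact: subset_trans phiO.
by apply: subclosed_compact cphi psub; exact: closed_closure.
Qed.

Lemma test_function_mulmx N M phi (A : 'M[R]_(N, M)) :
  test_function Omega phi -> test_function Omega (fun x => phi x *m A).
Proof.
move=> tphi; apply: (test_functionS tphi) => [k|x ->]; last by rewrite mul0mx.
by have [sphi _ _] := tphi; apply/CkE/Cnk_mulmx/CkE.
Qed.

Lemma test_function_smooth_enorm N M (e : R) (phi : 'rV[R]_n -> 'rV[R]_N)
    (w : 'rV[R]_M) : 0 < e -> test_function Omega phi ->
  test_function Omega (fun x => smooth_enorm e (phi x) *: w).
Proof.
move=> e0 tphi; apply: (test_functionS tphi) => [k|x ->]; last first.
  by rewrite smooth_enorm0 ?scale0r// ltW.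
by have [sphi _ _] := tphi; apply/CkE/CnkZl/Cnk_smooth_enorm => //; apply/CkE.
Qed.

Lemma test_function_continuous N (phi : 'rV[R]_n -> 'rV[R]_N) :
  test_function Omega phi -> continuous phi.
Proof. by case=> sphi _ _; exact: (sphi 0%N). Qed.

Lemma test_function_out N (phi : 'rV[R]_n -> 'rV[R]_N) x :
  test_function Omega phi -> ~ Omega x -> phi x = 0.
Proof.
move=> [_ _ phiO] nOx; apply/eqP/negPn/negP => phix.
by apply/nOx/phiO; exact: subset_closure.
Qed.

End test_functions.

(** * Measurability *)

Section measurability.
Variables (R : realType) (n : nat).

(** The sigma-algebra is generated by the coordinates, while open sets are
    unions of open boxes; the boxes with rational centre and radius are
    countably many and suffice. *)
Lemma open_measurable_rV (A : set 'rV[R]_n) : open A -> measurable A.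
Proof.
move=> oA.
pose box (k : 'rV[rat]_n * rat) : set 'rV[R]_n :=
  [set x | forall i, `|x ord0 i - ratr (k.1 ord0 i)| < ratr k.2].
have mbox k : measurable (box k).
  rewrite (_ : box k = \bigcap_(i in [set: 'I_n])
      ((fun x : 'rV[R]_n => x ord0 i : measurableTypeR R) @^-1`
       (ball (ratr (k.1 ord0 i) : R) (ratr k.2)))); last first.
    apply/seteqP; split=> [x h i _|x h i].
      by rewrite /preimage/= /ball/= distrC; exact: h.
    by have := h i I; rewrite /preimage/= /ball/= distrC.
  apply: fin_bigcap_measurable => // i _.
  rewrite -[X in measurable X]setTI.
  apply: (@measurable_rV_coord R n i measurableT).
  by rewrite ball_itv; exact: measurable_itv.
have -> : A = \bigcup_k (if `[< box k `<=` A >] then box k else set0).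
  apply/seteqP; split=> [x Ax|x [k _]]; last first.
    by case: ifPn => [/asboolP|_ []]; apply.
  have /nbhs_ballP[e /= e0 eA] : nbhs x A by exact: open_nbhs_nbhs.
  have e20 : 0 < e / 2 by rewrite divr_gt0.
  have [r] := rat_in_itvoo e20; rewrite in_itv/= => /andP[r0 re].
  have /choice[q xq] : forall i : 'I_n, exists q : rat, `|x ord0 i - ratr q| < ratr r.
    move=> i; have xr : x ord0 i < x ord0 i + ratr r by rewrite ltrDl.
    have [q] := rat_in_itvoo xr; rewrite in_itv/= => /andP[q0 q1].
    by exists q; rewrite ltr_norml; apply/andP; split; lra.
  exists (\row_i q i, r) => //.
  have kA : box (\row_i q i, r) `<=` A.
    move=> y; rewrite /box/= => xy; apply: eA; split=> // i j.
    rewrite (ord1 i) /ball/=; have := xy j; have := xq j; rewrite mxE => xqj yqj.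
    rewrite (le_lt_trans (ler_distD (ratr (q j)) _ _))//.
    by rewrite [X in _ + X]distrC; lra.
  by rewrite asboolT// /box/= => i; rewrite mxE; exact: xq.
apply: countable_bigcupT_measurable => [|k]; first exact: countableP.
by case: ifP => _ //; exact: measurable0.
Qed.

Lemma continuous_measurable_rV N (f : 'rV[R]_n -> 'rV[R]_N) :
  continuous f -> measurable_fun [set: 'rV[R]_n] f.
Proof.
move=> cf; apply: measurable_fun_rV => i.
apply: (measurability _ (RGenOpens.measurableE R)).
move=> _ [_ [a [b ->] <-]]; rewrite setTI; apply: open_measurable_rV.
have /continuousP : continuous (fun x => f x ord0 i).
  move=> x; apply: (@continuous_comp _ _ _ f (fun M => M ord0 i)).
    exact: cf.
  exact: coord_continuous.
by apply; exact: interval_open.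
Qed.

Lemma measurable_enorm : measurable_fun [set: 'rV[R]_n] (@enorm R n : _ -> R).
Proof.
rewrite (_ : @enorm R n = fun x => (\sum_(i < n) x ord0 i ^+ 2) `^ 2^-1).
  apply: (@measurableT_comp _ _ _ _ _ _ (@powR R ^~ 2^-1)) => //.
  apply: measurable_sum => i; apply: measurable_funX.
  exact: measurable_rV_coord.
apply/funext => x; rewrite powR12_sqrt//.
by apply: sumr_ge0 => i _; rewrite sqr_ge0.
Qed.

Lemma measurable_enorm_comp d (T : measurableType d) (f : T -> 'rV[R]_n) :
  measurable_fun setT f -> measurable_fun setT (fun x => enorm (f x) : R).
Proof. exact: measurableT_comp measurable_enorm. Qed.

Lemma measurable_coord_comp d (T : measurableType d) (f : T -> 'rV[R]_n) i :
  measurable_fun setT f -> measurable_fun setT (fun x => f x ord0 i : R).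
Proof. exact: measurableT_comp (measurable_rV_coord i). Qed.

Lemma measurable_rVB d (T : measurableType d) (f g : T -> 'rV[R]_n) :
  measurable_fun setT f -> measurable_fun setT g ->
  measurable_fun setT (fun x => f x - g x).
Proof.
move=> mf mg; apply: measurable_fun_rV => i.
under eq_fun do rewrite !mxE.
by apply: measurable_funB; exact: measurable_coord_comp.
Qed.

Lemma measurable_mulmx d (T : measurableType d) N (f : T -> 'rV[R]_n)
    (A : 'M[R]_(n, N)) :
  measurable_fun setT f -> measurable_fun setT (fun x => f x *m A).
Proof.
move=> mf; apply: measurable_fun_rV => i.
under eq_fun do rewrite mxE.
apply: measurable_sum => j; apply: measurable_funM => //.
exact: measurable_coord_comp.
Qed.

Lemma measurable_powR_comp d (T : measurableType d) (f : T -> R) (r : R) :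
  measurable_fun setT f -> measurable_fun setT (fun x => f x `^ r).
Proof. exact: (@measurableT_comp _ _ _ _ _ _ (@powR R ^~ r)). Qed.

End measurability.

(** * Integration *)

Lemma lee_poweRV (R : realType) (p c : R) (x : \bar R) : 0 < p -> 0 <= c ->
  (0 <= x)%E -> (x `^ p^-1 <= c%:E)%E = (x <= (c `^ p)%:E)%E.
Proof.
move=> p0 c0; have pn0 : p != 0 by rewrite gt_eqF.
case: x => [x|_|//]; last by rewrite poweRyr ?invr_eq0// !leye_eq.
rewrite lee_fin => x0; rewrite poweR_EFin !lee_fin; apply/idP/idP => h.
  have := ge0_ler_powR (ltW p0) (powR_ge0 _ _ : _ \in Num.nneg) c0 h.
  by rewrite -powRrM mulVf// powRr1.
have := ge0_ler_powR (r := p^-1) _ x0 (powR_ge0 _ _ : _ \in Num.nneg) h.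
by rewrite invr_ge0 (ltW p0) -powRrM mulfV// powRr1//; exact.
Qed.

Section integration.
Context d (T : measurableType d) (R : realType).
Variable mu : {measure set T -> \bar R}.

(** Fatou's lemma for almost everywhere convergence, read as lower
    semicontinuity: strict lower bounds of the integral of the limit are
    eventually lower bounds of the integrals. *)
Lemma fatou_lt (D : set T) (f_ : nat -> T -> R) (f : T -> R) (r : \bar R) :
  measurable D ->
  (forall k, measurable_fun setT (f_ k)) -> measurable_fun setT f ->
  (forall k x, 0 <= f_ k x) -> (forall x, 0 <= f x) ->
  {ae mu, forall x, f_ ^~ x @ \oo --> f x} ->
  (r < \int[mu]_(x in D) (f x)%:E)%E ->
  \forall k \near \oo, (r < \int[mu]_(x in D) (f_ k x)%:E)%E.
Proof.
move=> mD mf_ mf f_0 f0 f_f rf.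
have mEf_ k : measurable_fun D (fun x => (f_ k x)%:E).
  by apply: measurable_funTS; exact/measurable_EFinP.
have f_E0 k x : D x -> (0 <= (f_ k x)%:E)%E by rewrite lee_fin.
have : (r < limn_einf (fun k => \int[mu]_(x in D) (f_ k x)%:E))%E.
  apply: (lt_le_trans rf); apply: le_trans (fatou mu mD mEf_ f_E0).
  apply: ae_ge0_le_integral => //.
  - by move=> x _; rewrite lee_fin.
  - by apply: measurable_funTS; exact/measurable_EFinP.
  - move=> x Dx; rewrite limn_einf_lim; apply: lime_ge; first exact: is_cvg_einfs.
    by near=> k; apply: le_ereal_inf_tmp => _ [m /= _ <-]; rewrite lee_fin.
  - apply: measurableT_comp => //; apply: measurable_fun_limn_esup => k.
    exact: measurableT_comp.
  - apply: filterS f_f => x f_f Dx.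
    have cf : (f_ k x)%:E @[k --> \oo] --> (f x)%:E.
      by apply: cvg_EFin f_f; exact: nearW.
    by rewrite (cvg_limn_einf_sup cf).
set I_ := fun k => _; rewrite limn_einf_lim.
rewrite (cvg_lim (@ereal_hausdorff R) (@cvg_einfs_sup R I_)).
move=> /ereal_sup_gt[_ [m _ <-] rm].
near=> k; apply: (lt_le_trans rm); apply: ereal_inf_lbound; exists k => //=.
by near: k; exists m.
Unshelve. all: by end_near. Qed.

(** The series of the [f_ k] has a finite integral, hence a finite sum, and so
    terms tending to zero, almost everywhere. *)
Lemma ae_cvg0_of_integral_geometric (f_ : nat -> T -> R) :
  (forall k, measurable_fun setT (f_ k)) -> (forall k x, 0 <= f_ k x) ->
  (forall k, (\int[mu]_x (f_ k x)%:E <= (2^-1 ^+ k)%:E)%E) ->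
  {ae mu, forall x, f_ ^~ x @ \oo --> 0}.
Proof.
move=> mf_ f_0 If_.
have mE k : measurable_fun setT (fun x => (f_ k x)%:E) by exact/measurable_EFinP.
have fE0 k x : setT x -> (0 <= (f_ k x)%:E)%E by rewrite lee_fin.
pose F x := (\sum_(k <oo) (f_ k x)%:E)%E.
have F0 x : (0 <= F x)%E by apply: nneseries_ge0 => k _ _; rewrite lee_fin.
have mF : measurable_fun setT F.
  apply: ge0_emeasurable_sum => [k x _ _|k _]; last exact: mE.
  by rewrite lee_fin.
have iF : mu.-integrable setT F.
  apply/integrableP; split => //.
  rewrite (_ : \int[mu]_x _ = \int[mu]_x F x)%E; last first.
    by apply: eq_integral => x _; rewrite gee0_abs.
  rewrite integral_nneseries//.
  apply: (@le_lt_trans _ _ (\sum_(k <oo) (2^-1 ^+ k)%:E)%E).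
    apply: lee_nneseries => [k _ _|k _]; last exact: If_.
    by apply: integral_ge0 => x _; rewrite lee_fin.
  have geo : (\sum_(0 <= k < m) (2^-1 ^+ k : R)%:E)%E @[m --> \oo] -->
      (1 * (1 - 2^-1)^-1 : R)%:E.
    apply: cvg_EFin; first by near=> m; rewrite sumEFin.
    rewrite (_ : _ \o _ = series (geometric 1 2^-1)); last first.
      apply/funext => m /=; rewrite sumEFin/= /series/=.
      by apply: eq_bigr => i _; rewrite mul1r.
    by apply: cvg_geometric_series; rewrite ger0_norm// invf_lt1 ?ltr1n.
  by rewrite (cvg_lim (@ereal_hausdorff R) geo) ltry.
apply: filterS (integrable_ae measurableT iF) => x /(_ I) Fx.
apply: cvg_series_cvg_0; apply: nondecreasing_is_cvgn.
  by apply/nondecreasing_series => k _ _.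
exists (fine (F x)) => _ [k _ <-]; rewrite -lee_fin fineK//.
by rewrite /series/= -sumEFin; apply: nneseries_lim_ge => i _ _; rewrite lee_fin.
Unshelve. all: by end_near. Qed.

(** Minkowski's inequality for a function that is only bounded by a sum, with
    the norms replaced by upper bounds: stated on integrals of p-th powers, it
    applies to the seminorm and to the norm alike. *)
Lemma minkowski_le (p a b : R) (f g h : T -> R) : 1 <= p -> 0 <= a -> 0 <= b ->
  measurable_fun setT f -> measurable_fun setT g -> measurable_fun setT h ->
  (forall x, 0 <= f x) -> (forall x, 0 <= g x) ->
  (forall x, 0 <= h x <= f x + g x) ->
  (\int[mu]_x (f x `^ p)%:E <= (a `^ p)%:E)%E ->
  (\int[mu]_x (g x `^ p)%:E <= (b `^ p)%:E)%E ->
  (\int[mu]_x (h x `^ p)%:E <= ((a + b) `^ p)%:E)%E.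
Proof.
move=> p1 a0 b0 mf mg mh f0 g0 hfg.
have p0 : 0 < p by rewrite (lt_le_trans ltr01).
have mp (k : T -> R) : measurable_fun setT k ->
    measurable_fun setT (fun x => (k x `^ p)%:E).
  by move=> mk; exact/measurable_EFinP/measurable_powR_comp.
have NE (k : T -> R) : (forall x, 0 <= k x) ->
    Lnorm mu p%:E (EFin \o k) = ((\int[mu]_x (k x `^ p)%:E) `^ p^-1)%E.
  move=> k0; rewrite unlock; congr (_ `^ _)%E.
  by apply: eq_integral => x _ /=; rewrite ger0_norm// poweR_EFin.
have I0 (k : T -> R) : (0 <= \int[mu]_x (k x `^ p)%:E)%E.
  by apply: integral_ge0 => x _; rewrite lee_fin powR_ge0.
have h0 x : 0 <= h x by case/andP: (hfg x).
rewrite -!lee_poweRV ?addr_ge0// -!NE// => fa gb.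
rewrite EFinD; apply: le_trans (leeD fa gb).
apply: le_trans (minkowski_EFin mu mf mg p1).
have fg0 x : 0 <= (f \+ g) x by rewrite /= addr_ge0.
rewrite !NE//.
apply: gt0_ler_poweR; rewrite ?invr_ge0 ?(ltW p0)// ?in_itv/= ?I0 ?leey//.
apply: ge0_le_integral => //.
- by move=> x _; rewrite lee_fin powR_ge0.
- exact: mp.
- exact/mp/measurable_funD.
move=> x _; have /andP[_ hl] := hfg x.
rewrite lee_fin; apply: ge0_ler_powR (ltW p0) _ _ (h0 x) (fg0 x) hl.
Qed.

End integration.

(** Differentiability gives continuity of the power away from [0] only; the
    limit [0] is handled through the inverse power. *)
Lemma cvg_powR_ge0 (R : realType) (p : R) (u_ : nat -> R) (l : R) : 0 < p ->
  (forall k, 0 <= u_ k) -> 0 <= l ->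
  u_ @ \oo --> l -> (fun k => u_ k `^ p) @ \oo --> l `^ p.
Proof.
move=> p0 u0; rewrite le_eqVlt => /predU1P[<-|l0] ul; last first.
  have cl : {for l, continuous (@powR R ^~ p)}.
    apply: differentiable_continuous; apply/derivable1_diffP.
    by apply: derivable_powR; rewrite in_itv/= andbT.
  exact: cvg_comp ul cl.
rewrite powR0 ?gt_eqF//; apply/cvgrPdist_le => e e0.
have ep : 0 < e `^ p^-1 by rewrite powR_gt0.
move/cvgrPdist_le : ul => /(_ _ ep); apply: filterS => k.
rewrite !sub0r !normrN !ger0_norm ?powR_ge0// => uk.
rewrite -[e in leRHS](powRr1 (ltW e0)) -(@mulVf _ p) ?gt_eqF// powRrM.
by rewrite ge0_ler_powR ?nnegrE ?powR_ge0 ?(ltW p0).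
Qed.

Section product_measure.
Context d (T : measurableType d) (R : realType).
Variable mu : {sigma_finite_measure set T -> \bar R}.

(** If [Z] is negligible, so are the strips [Z * T] and [T * Z], which have
    measure [0 * oo] at most. *)
Lemma ae_prod (P : set T) : {ae mu, forall x, P x} ->
  {ae (mu \x mu)%E, forall z, P z.1 /\ P z.2}.
Proof.
move=> [Z [mZ Z0 PZ]].
have N1 : (mu \x mu)%E.-negligible (Z `*` setT).
  exists (Z `*` setT); split=> //; first exact: measurableX.
  apply: etrans (product_measure1E mu mu mZ measurableT) _.
  by rewrite [X in (X * _)%E](Z0 : _ = 0%E) mul0e.
have N2 : (mu \x mu)%E.-negligible (setT `*` Z).
  exists (setT `*` Z); split=> //; first exact: measurableX.
  apply: etrans (product_measure1E mu mu measurableT mZ) _.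
  by rewrite [X in (_ * X)%E](Z0 : _ = 0%E) mule0.
apply: negligibleS (negligibleU N1 N2) => z /= nP; apply: contrapT => nZ.
apply: nP; split; apply: contrapT => nPz; apply: nZ; [left|right]; split=> //;
  exact: PZ.
Qed.

(** Vanishing almost everywhere on the product, put in iterated form so that
    the first variable can be fixed. *)
Lemma ge0_integral_prod_eq0 (f : T * T -> R) : measurable_fun setT f ->
  (forall z, 0 <= f z) -> (\int[(mu \x mu)%E]_z (f z)%:E = 0)%E ->
  {ae mu, forall x, {ae mu, forall y, f (x, y) = 0}}.
Proof.
move=> mf f0; have mE : measurable_fun setT (EFin \o f) by exact/measurable_EFinP.
have fE0 z : (0 <= (EFin \o f) z)%E by rewrite lee_fin.
rewrite (@fubini_tonelli1 _ _ _ _ _ mu mu (EFin \o f) mE fE0) => If0.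
have : {ae mu, forall x, setT x -> fubini_F mu (EFin \o f) x = 0%E}.
  apply/(ae_eq_integral_abs mu measurableT).
    exact: measurable_fun_fubini_tonelli_F.
  rewrite -[RHS]If0; apply: eq_integral => x _.
  by rewrite gee0_abs//; apply: integral_ge0.
apply: filterS => x /(_ I) Fx.
have : {ae mu, forall y, setT y -> (f (x, y))%:E = 0%E}.
  apply/(ae_eq_integral_abs mu measurableT).
    by apply/measurable_EFinP; exact: measurableT_comp mf (measurable_pair1 x).
  rewrite -[RHS]Fx; apply: eq_integral => y _.
  by rewrite gee0_abs// lee_fin.
by apply: filterS => y /(_ I) [].
Qed.

End product_measure.

(** * Gagliardo seminorm and Sobolev norm *)

Section gagliardo.
Variables (R : realType) (n : nat) (s p : R).
Hypothesis p1 : 1 < p.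
Local Notation V := 'rV[R]_n.
Local Notation leb := (lebesgue_rV R n).

Let p0 : 0 < p. Proof. exact: lt_trans ltr01 p1. Qed.

(** The p-th root of the singular kernel: with it the seminorm is the L^p norm,
    over the product space, of a quantity [difference_quotient] that is
    subadditive in the function. *)
Definition gagliardo_weight (z : V * V) : R :=
  (enorm (z.1 - z.2) `^ (n%:R + s * p)) `^ (- p^-1).

Definition difference_quotient N (v : V -> 'rV[R]_N) (z : V * V) : R :=
  enorm (v z.1 - v z.2) * gagliardo_weight z.

Lemma gagliardo_weight_ge0 z : 0 <= gagliardo_weight z.
Proof. exact: powR_ge0. Qed.

Lemma gagliardo_weight_gt0 x y : x != y -> 0 < gagliardo_weight (x, y).
Proof.
move=> xy; apply/powR_gt0/powR_gt0; rewrite lt_neqAle enorm_ge0 andbT eq_sym.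
by apply: contra_neq xy => /enorm_eq0/eqP; rewrite subr_eq0 => /eqP.
Qed.

Lemma difference_quotient_ge0 N (v : V -> 'rV[R]_N) z :
  0 <= difference_quotient v z.
Proof. by rewrite mulr_ge0 ?enorm_ge0 ?gagliardo_weight_ge0. Qed.

Lemma difference_quotient_powR N (v : V -> 'rV[R]_N) z :
  difference_quotient v z `^ p =
  enorm (v z.1 - v z.2) `^ p / enorm (z.1 - z.2) `^ (n%:R + s * p).
Proof.
rewrite powRM ?enorm_ge0 ?gagliardo_weight_ge0//; congr (_ * _).
by rewrite -powRrM mulNr mulVf ?gt_eqF// powRN powRr1 ?powR_ge0.
Qed.

Lemma measurable_gagliardo_weight : measurable_fun setT gagliardo_weight.
Proof.
apply/measurable_powR_comp/measurable_powR_comp/measurable_enorm_comp.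
by apply: measurable_rVB; [exact: measurable_fst|exact: measurable_snd].
Qed.

Lemma measurable_difference_quotient N (v : V -> 'rV[R]_N) :
  measurable_fun setT v -> measurable_fun setT (difference_quotient v).
Proof.
move=> mv; apply: measurable_funM; last exact: measurable_gagliardo_weight.
apply/measurable_enorm_comp/measurable_rVB.
  exact: measurableT_comp mv measurable_fst.
exact: measurableT_comp mv measurable_snd.
Qed.

Lemma measurable_difference_quotient_powR N (v : V -> 'rV[R]_N) :
  measurable_fun setT v ->
  measurable_fun setT (fun z => difference_quotient v z `^ p).
Proof.
by move=> mv; apply: measurable_powR_comp; exact: measurable_difference_quotient.
Qed.

Lemma gagliardoE N (v : V -> 'rV[R]_N) : measurable_fun setT v ->
  gagliardo s p v =
  (\int[(leb \x leb)%E]_z (difference_quotient v z `^ p)%:E)%E.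
Proof.
move=> mv; rewrite fubini_tonelli1.
- rewrite /gagliardo /fubini_F; apply: eq_integral => x _.
  by apply: eq_integral => y _; rewrite difference_quotient_powR.
- by apply/measurable_EFinP; exact: measurable_difference_quotient_powR.
- by move=> z; rewrite lee_fin powR_ge0.
Qed.

Lemma gagliardo_ge0 N (v : V -> 'rV[R]_N) : (0 <= gagliardo s p v)%E.
Proof.
apply: integral_ge0 => x _; apply: integral_ge0 => y _.
by rewrite lee_fin divr_ge0 ?powR_ge0.
Qed.

Definition pmass N (D : set V) (v : V -> 'rV[R]_N) : \bar R :=
  (\int[leb]_(x in D) (enorm (v x) `^ p)%:E)%E.

Lemma pmass_ge0 N D (v : V -> 'rV[R]_N) : (0 <= pmass D v)%E.
Proof. by apply: integral_ge0 => x _; rewrite lee_fin powR_ge0. Qed.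

Lemma measurable_enorm_powR N (v : V -> 'rV[R]_N) :
  measurable_fun setT v -> measurable_fun setT (fun x => enorm (v x) `^ p).
Proof. by move=> mv; exact/measurable_powR_comp/measurable_enorm_comp. Qed.

Lemma pmassS N D (v : V -> 'rV[R]_N) : measurable D -> measurable_fun setT v ->
  (pmass D v <= pmass setT v)%E.
Proof.
move=> mD mv; apply: ge0_subset_integral => //.
- by apply/measurable_EFinP; exact: measurable_enorm_powR.
- by move=> x _; rewrite lee_fin powR_ge0.
Qed.

Lemma sobolev_norm_leE N (v : V -> 'rV[R]_N) (e : R) : 0 <= e ->
  (sobolev_norm s p v <= e%:E)%E =
  (pmass setT v + gagliardo s p v <= (e `^ p)%:E)%E.
Proof. by move=> e0; rewrite lee_poweRV// adde_ge0 ?gagliardo_ge0 ?pmass_ge0. Qed.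

Lemma pmass_le_sobolev N (v : V -> 'rV[R]_N) (e : R) : 0 <= e ->
  (sobolev_norm s p v <= e%:E)%E -> (pmass setT v <= (e `^ p)%:E)%E.
Proof.
move=> e0; rewrite sobolev_norm_leE//; apply: le_trans.
by rewrite leeDl// gagliardo_ge0.
Qed.

Lemma gagliardo_le_sobolev N (v : V -> 'rV[R]_N) (e : R) : 0 <= e ->
  (sobolev_norm s p v <= e%:E)%E -> (gagliardo s p v <= (e `^ p)%:E)%E.
Proof.
move=> e0; rewrite sobolev_norm_leE//; apply: le_trans.
by rewrite leeDr// pmass_ge0.
Qed.

Lemma sobolev_norm_lty N (v : V -> 'rV[R]_N) : (sobolev_norm s p v < +oo)%E =
  (pmass setT v < +oo)%E && (gagliardo s p v < +oo)%E.
Proof.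
have M0 := pmass_ge0 setT v; have G0 := gagliardo_ge0 v.
apply/idP/andP => [/lty_poweRy|[Mf Gf]]; last exact/poweR_lty/lte_add_pinfty.
rewrite invr_neq0 ?gt_eqF// => /(_ isT) h; split; apply: le_lt_trans h.
  by rewrite leeDl.
by rewrite leeDr.
Qed.

(** A function with smaller values and smaller increments has smaller norms;
    both the linear maps of norm at most one and the smooth lengths are used
    only through this. *)
Section domination.
Variables (N M : nat) (v : V -> 'rV[R]_N) (w : V -> 'rV[R]_M).
Hypotheses (mv : measurable_fun setT v) (mw : measurable_fun setT w).
Hypothesis wv : forall x, enorm (w x) <= enorm (v x).
Hypothesis dwv : forall x y, enorm (w x - w y) <= enorm (v x - v y).

Lemma le_difference_quotient z :
  difference_quotient w z <= difference_quotient v z.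
Proof. by rewrite ler_wpM2r ?gagliardo_weight_ge0. Qed.

Lemma le_gagliardo : (gagliardo s p w <= gagliardo s p v)%E.
Proof.
rewrite (gagliardoE mw) (gagliardoE mv); apply: ge0_le_integral => //.
- by move=> x _; rewrite lee_fin powR_ge0.
- by apply/measurable_EFinP; exact: measurable_difference_quotient_powR.
- by apply/measurable_EFinP; exact: measurable_difference_quotient_powR.
move=> z _; rewrite lee_fin.
apply: ge0_ler_powR; rewrite ?nnegrE ?difference_quotient_ge0 ?(ltW p0)//.
exact: le_difference_quotient.
Qed.

Lemma le_pmass : (pmass setT w <= pmass setT v)%E.
Proof.
apply: ge0_le_integral => //.
- by move=> x _; rewrite lee_fin powR_ge0.
- by apply/measurable_EFinP; exact: measurable_enorm_powR.
- by apply/measurable_EFinP; exact: measurable_enorm_powR.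
move=> x _; rewrite lee_fin.
by apply: ge0_ler_powR; rewrite ?nnegrE ?enorm_ge0 ?(ltW p0).
Qed.

Lemma le_sobolev_norm : (sobolev_norm s p w <= sobolev_norm s p v)%E.
Proof.
have ge0 M' (f : V -> 'rV[R]_M') :
    (pmass setT f + gagliardo s p f)%E \in `[0, +oo]%E.
  by rewrite in_itv/= leey andbT; apply: adde_ge0;
    [exact: pmass_ge0|exact: gagliardo_ge0].
rewrite /sobolev_norm; apply: gt0_ler_poweR (ge0 _ w) (ge0 _ v) _.
  by rewrite invr_ge0 ltW.
by apply: leeD; [exact: le_pmass|exact: le_gagliardo].
Qed.

End domination.

(** The triangle inequality [[w] <= [v] + [v - w]], which makes the seminorms
    of an approximating sequence converge. *)
Lemma gagliardo_minkowski N (v w : V -> 'rV[R]_N) (a b : R) :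
  measurable_fun setT v -> measurable_fun setT w -> 0 <= a -> 0 <= b ->
  (gagliardo s p v <= (a `^ p)%:E)%E ->
  (gagliardo s p (fun x => (v x - w x)%R) <= (b `^ p)%:E)%E ->
  (gagliardo s p w <= ((a + b) `^ p)%:E)%E.
Proof.
move=> mv mw a0 b0; have mvw := measurable_rVB mv mw.
rewrite (gagliardoE mv) (gagliardoE mvw) (gagliardoE mw); apply: minkowski_le => //; first exact: ltW.
1-3: exact: measurable_difference_quotient.
1-2: by move=> z; exact: difference_quotient_ge0.
move=> z; rewrite difference_quotient_ge0/= -mulrDl.
rewrite ler_wpM2r ?gagliardo_weight_ge0//.
have telescope (x1 x2 y1 y2 : 'rV[R]_N) : y1 - y2 = (x1 - x2) - ((x1 - y1) - (x2 - y2)).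
  by apply/rowP => i; rewrite !mxE; ring.
by rewrite [X in enorm X](telescope (v z.1) (v z.2)); exact: ler_enormB.
Qed.

Lemma pmass_minkowski N (v w : V -> 'rV[R]_N) (a b : R) :
  measurable_fun setT v -> measurable_fun setT w -> 0 <= a -> 0 <= b ->
  (pmass setT v <= (a `^ p)%:E)%E ->
  (pmass setT (fun x => (v x - w x)%R) <= (b `^ p)%:E)%E ->
  (pmass setT w <= ((a + b) `^ p)%:E)%E.
Proof.
move=> mv mw a0 b0; have mvw := measurable_rVB mv mw.
apply: minkowski_le => //; first exact: ltW.
1-3: exact: measurable_enorm_comp.
1-2: by move=> z; exact: enorm_ge0.
move=> z; rewrite enorm_ge0/=.
rewrite [X in enorm X](_ : _ = v z - (v z - w z)); first exact: ler_enormB.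
by rewrite opprB addrC subrK.
Qed.

End gagliardo.

(** * The space of functions vanishing outside the domain *)

Section sobolev0.
Variables (R : realType) (n : nat) (s p : R) (Omega : set 'rV[R]_n).
Hypotheses (p1 : 1 < p) (oOmega : open Omega).
Local Notation V := 'rV[R]_n.
Local Notation leb := (lebesgue_rV R n).

Let p0 : 0 < p. Proof. exact: lt_trans ltr01 p1. Qed.
Let mOmega : measurable Omega. Proof. exact: open_measurable_rV. Qed.

Lemma measurable_test_function N (phi : V -> 'rV[R]_N) :
  test_function Omega phi -> measurable_fun setT phi.
Proof.
move=> tphi; apply: continuous_measurable_rV.
exact: test_function_continuous tphi.
Qed.

Lemma sobolev_norm0 N : sobolev_norm s p (fun _ : V => 0 : 'rV[R]_N) = 0%E.
Proof.
apply/eqP; rewrite eq_le poweR_ge0 andbT sobolev_norm_leE//.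
rewrite powR0 ?gt_eqF// /pmass integral0_eq ?add0e; last first.
  by move=> x _; rewrite enorm0 powR0// gt_eqF.
rewrite /gagliardo integral0_eq// => x _; rewrite integral0_eq// => y _.
by rewrite subr0 enorm0 powR0 ?mul0r// gt_eqF.
Qed.

Lemma test_function_sobolev0 N (phi : V -> 'rV[R]_N) :
  test_function Omega phi -> (sobolev_norm s p phi < +oo)%E ->
  sobolev0 s p Omega phi.
Proof.
move=> tphi fphi; split; first by split=> //; exact: measurable_test_function.
move=> e e0; exists phi; split=> //.
by under eq_fun do rewrite subrr; rewrite sobolev_norm0 lte_fin.
Qed.

Lemma sobolev0_mulmx N M (A : 'M[R]_(N, M)) (v : V -> 'rV[R]_N) :
  (forall a, enorm (a *m A) <= enorm a) ->
  sobolev0 s p Omega v -> sobolev0 s p Omega (fun x => v x *m A).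
Proof.
move=> A1 [[mv fv] av].
have dA (w : V -> 'rV[R]_N) x y :
    enorm (w x *m A - w y *m A) <= enorm (w x - w y) by rewrite -mulmxBl.
split; first split.
- exact: measurable_mulmx.
- by apply: le_lt_trans fv; apply: le_sobolev_norm => //; exact: measurable_mulmx.
move=> e /av[phi [tphi phie]]; exists (fun x => phi x *m A).
split; first exact: test_function_mulmx.
apply: le_lt_trans phie.
rewrite (_ : (fun x => _) = fun x => (v x - phi x) *m A); last first.
  by apply/funext => x; rewrite mulmxBl.
have mvphi := measurable_rVB mv (measurable_test_function tphi).
apply: le_sobolev_norm => //; first exact: measurable_mulmx.
exact: (dA (fun x => v x - phi x)).
Qed.

(** The geometric rate makes the approximation converge almost everywhere,
    not only in norm. *)
Lemma sobolev0_approx N (v : V -> 'rV[R]_N) : sobolev0 s p Omega v ->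
  exists phi : nat -> V -> 'rV[R]_N,
    [/\ forall k, test_function Omega (phi k),
        forall k, (sobolev_norm s p (fun x => (v x - phi k x)%R)
                    <= (2^-1 ^+ k)%:E)%E &
        {ae leb, forall x, enorm (v x - phi k x) @[k --> \oo] --> 0}].
Proof.
move=> [[mv fv] av].
have h0 k : 0 < 2^-1 ^+ k :> R by rewrite exprn_gt0// invr_gt0.
have /choice[phi phiP] : forall k, exists phi, test_function Omega phi /\
    (sobolev_norm s p (fun x => (v x - phi x)%R) < (2^-1 ^+ k)%:E)%E.
  by move=> k; exact: av.
have mvphi k := measurable_rVB mv (measurable_test_function (phiP k).1).
exists phi; split=> [k|k|]; [by have [] := phiP k|by have [_ /ltW] := phiP k|].
have := @ae_cvg0_of_integral_geometric _ _ _ leb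
  (fun k x => enorm (v x - phi k x) `^ p).
move=> /(_ (fun k => measurable_enorm_powR p (mvphi k)) (fun k x => powR_ge0 _ _)).
have Ik k : (\int[leb]_x (enorm (v x - phi k x) `^ p)%:E <= (2^-1 ^+ k)%:E)%E.
  have [_ /ltW /(pmass_le_sobolev p1 (ltW (h0 k)))] := phiP k.
  move=> /le_trans; apply; rewrite lee_fin; apply: ge1r_powR; last exact: ltW.
  by rewrite h0/= exprn_ile1// invf_le1// ler1n.
move=> /(_ Ik); apply: filterS => x.
have pV0 : 0 < p^-1 by rewrite invr_gt0.
move=> /(cvg_powR_ge0 pV0 (fun k => powR_ge0 _ _) (lexx _)).
rewrite powR0 ?gt_eqF//; under eq_fun.
  by move=> k; rewrite -powRrM mulfV ?gt_eqF// powRr1 ?enorm_ge0//; over.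
exact.
Qed.

(** Test functions vanish off the domain, and so does their almost everywhere
    limit. *)
Lemma sobolev0_out N (v : V -> 'rV[R]_N) : sobolev0 s p Omega v ->
  {ae leb, forall x, ~ Omega x -> v x = 0}.
Proof.
move=> /sobolev0_approx[phi [tphi _]]; apply: filterS => x phiv nOx.
apply: enorm_eq0; move: phiv.
under eq_fun do rewrite (test_function_out (tphi _) nOx) subr0.
move=> /(cvg_lim (@Rhausdorff R)) <-.
by rewrite lim_cst//; exact: Rhausdorff.
Qed.

Lemma sobolev0_pmass_fin N (v : V -> 'rV[R]_N) : sobolev0 s p Omega v ->
  pmass p Omega v \is a fin_num.
Proof.
move=> [[mv fv] _]; rewrite ge0_fin_numE ?pmass_ge0//.
apply: le_lt_trans (pmassS p mOmega mv) _.
by move: fv; rewrite sobolev_norm_lty// => /andP[].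
Qed.

(** The denominator of the quotient only sees the domain, but this is where
    the function lives. *)
Lemma sobolev0_pmass_eq0 N (v : V -> 'rV[R]_N) : sobolev0 s p Omega v ->
  pmass p Omega v = 0%E -> {ae leb, forall x, v x = 0}.
Proof.
move=> s0v v0; have [[mv _] _] := s0v.
have : {ae leb, forall x, Omega x -> (enorm (v x) `^ p)%:E = 0%E}.
  apply/(ae_eq_integral_abs leb mOmega).
    apply: measurable_funTS.
    by apply/measurable_EFinP; exact: measurable_enorm_powR.
  by rewrite -[RHS]v0; apply: eq_integral => x _; rewrite gee0_abs// lee_fin powR_ge0.
apply: filterS2 (sobolev0_out s0v) => x vout vin.
have [/vin[] /powR_eq0_eq0/enorm_eq0//|/vout//] := pselect (Omega x).
Qed.

Lemma sobolev0_pmass_gt0 N (v : V -> 'rV[R]_N) : sobolev0 s p Omega v ->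
  nontrivial v -> (0 < pmass p Omega v)%E.
Proof.
move=> s0v nv; rewrite lt_neqAle pmass_ge0 andbT eq_sym.
by apply/eqP => /(sobolev0_pmass_eq0 s0v).
Qed.

Lemma Lambda_le_rayleigh N (v : V -> 'rV[R]_N) : sobolev0 s p Omega v ->
  nontrivial v -> (Lambda N s p Omega <= rayleigh s p Omega v)%E.
Proof. by move=> s0v nv; apply: ereal_inf_lbound; exists v. Qed.

(** Multiplying by the denominator makes the bound meaningful, and true, for
    functions vanishing almost everywhere as well; nontriviality of the
    approximations of a minimizer then never has to be discussed. *)
Lemma Lambda_pmass_le N (v : V -> 'rV[R]_N) (A : R) :
  Lambda N s p Omega = A%:E -> sobolev0 s p Omega v ->
  (A%:E * pmass p Omega v <= gagliardo s p v)%E.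
Proof.
move=> LA s0v; have [v0|nv] := pselect {ae leb, forall x, v x = 0}.
  rewrite /pmass (_ : \int[leb]_(x in Omega) _ = 0)%E ?mule0 ?gagliardo_ge0//.
  rewrite -[RHS](integral0 leb Omega); have [[mv _] _] := s0v.
  apply: ge0_ae_eq_integral => //.
  - apply: measurable_funTS.
    by apply/measurable_EFinP; exact: measurable_enorm_powR.
  - by move=> x _; rewrite lee_fin powR_ge0.
  - by apply: filterS v0 => x -> _; rewrite enorm0 powR0// gt_eqF.
have := Lambda_le_rayleigh s0v nv.
rewrite LA /rayleigh -/(pmass p Omega v).
have := sobolev0_pmass_gt0 s0v nv.
have := sobolev0_pmass_fin s0v.
case: (pmass p Omega v) => // m _; rewrite lte_fin => m0.
by rewrite inver gt_eqF// lee_pdivlMr.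
Qed.

End sobolev0.

(** * Minimizers *)

Section minimizers.
Variables (R : realType) (n N : nat) (s p : R) (Omega : set 'rV[R]_n).
Hypotheses (p1 : 1 < p) (oOmega : open Omega).
Local Notation V := 'rV[R]_n.
Local Notation leb := (lebesgue_rV R n).
Local Notation weight := (gagliardo_weight s p).
Local Notation quotient := (difference_quotient s p).

Let p0 : 0 < p. Proof. exact: lt_trans ltr01 p1. Qed.
Let mOmega : measurable Omega. Proof. exact: open_measurable_rV. Qed.

(** The seminorm density lost when [v] is replaced by the scalar function
    [f]; it is nonnegative as soon as [f] oscillates less than [v]. *)
Definition gagliardo_defect (v : V -> 'rV[R]_N) (f : V -> R) (z : V * V) : R :=
  quotient v z `^ p - (`|f z.1 - f z.2| * weight z) `^ p.

Lemma gagliardo_defect_ge0 v f z : `|f z.1 - f z.2| <= enorm (v z.1 - v z.2) ->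
  0 <= gagliardo_defect v f z.
Proof.
move=> fv; have w0 := gagliardo_weight_ge0 s p z.
rewrite subr_ge0; apply: (ge0_ler_powR (ltW p0)).
- by rewrite nnegrE mulr_ge0.
- by rewrite nnegrE mulr_ge0// enorm_ge0.
- exact: ler_wpM2r.
Qed.

Lemma measurable_gagliardo_defect v f : measurable_fun setT v ->
  measurable_fun setT f -> measurable_fun setT (gagliardo_defect v f).
Proof.
move=> mv mf; apply: measurable_funB.
  exact: measurable_difference_quotient_powR.
apply: measurable_powR_comp; apply: measurable_funM; last first.
  exact: measurable_gagliardo_weight.
apply: measurableT_comp => //; apply: measurable_funB.
  exact: measurableT_comp mf measurable_fst.
exact: measurableT_comp mf measurable_snd.
Qed.

(** The vector function [f e] has increments of length [|f x - f y|], so its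
    seminorm is exactly what the defect leaves over. *)
Lemma gagliardo_defectE (v : V -> 'rV[R]_N) (f : V -> R) (e : 'rV[R]_N) :
  enorm e = 1 -> measurable_fun setT v -> measurable_fun setT f ->
  measurable_fun setT (fun x => f x *: e) ->
  (forall x y, `|f x - f y| <= enorm (v x - v y)) ->
  gagliardo s p v = (gagliardo s p (fun x => f x *: e) +
    \int[(leb \x leb)%E]_z (gagliardo_defect v f z)%:E)%E.
Proof.
move=> e1 mv mf mfe fv.
rewrite (gagliardoE s p1 mv) (gagliardoE s p1 mfe) -ge0_integralD//.
- apply: eq_integral => z _; rewrite -EFinD; congr (_%:E).
  rewrite /gagliardo_defect [X in _ = X + _](_ : _ =
    (`|f z.1 - f z.2| * weight z) `^ p); last first.
    by rewrite /difference_quotient -scalerBl enormZ e1 mulr1.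
  by rewrite addrC subrK.
- by move=> z _; rewrite lee_fin powR_ge0.
- by apply/measurable_EFinP; exact: measurable_difference_quotient_powR.
- by move=> z _; rewrite lee_fin gagliardo_defect_ge0.
- by apply/measurable_EFinP; exact: measurable_gagliardo_defect.
Qed.

Lemma gagliardo_defect_cvg (v_ : nat -> V -> 'rV[R]_N) (f_ : nat -> V -> R)
    (v : V -> 'rV[R]_N) (f : V -> R) z :
  (enorm (v z.1 - v_ k z.1) @[k --> \oo] --> 0) ->
  (enorm (v z.2 - v_ k z.2) @[k --> \oo] --> 0) ->
  (f_ k z.1 @[k --> \oo] --> f z.1) -> (f_ k z.2 @[k --> \oo] --> f z.2) ->
  gagliardo_defect (v_ k) (f_ k) z @[k --> \oo] --> gagliardo_defect v f z.
Proof.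
move=> v1 v2 f1 f2.
have w0 := gagliardo_weight_ge0 s p z.
apply: cvgB; (apply: cvg_powR_ge0 => [//|k||]; last apply: cvgMr_tmp).
- by rewrite mulr_ge0// enorm_ge0.
- by rewrite mulr_ge0// enorm_ge0.
- apply/cvgrPdist_le => e e0.
  have /cvgrPdist_le/(_ _ e0) : (enorm (v z.1 - v_ k z.1) +
      enorm (v z.2 - v_ k z.2)) @[k --> \oo] --> (0 : R).
    by rewrite -[0]addr0; exact: cvgD.
  apply: filterS => k; rewrite sub0r normrN ger0_norm ?addr_ge0 ?enorm_ge0//.
  apply: le_trans; apply: le_trans (ler_dist_enorm _ _) _.
  have swap (x1 x2 y1 y2 : 'rV[R]_N) : x1 - x2 - (y1 - y2) = x1 - y1 - (x2 - y2).
    by rewrite !opprD !opprK addrACA.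
  by rewrite swap; exact: ler_enormB.
- by rewrite mulr_ge0.
- by rewrite mulr_ge0.
- by apply: cvg_norm; exact: cvgB.
Qed.

Lemma smooth_enorm_cvg (a_ : nat -> 'rV[R]_N) (a : 'rV[R]_N) (e_ : nat -> R) :
  (forall k, 0 <= e_ k) -> e_ @ \oo --> 0 ->
  (enorm (a - a_ k) @[k --> \oo] --> 0) ->
  smooth_enorm (e_ k) (a_ k) @[k --> \oo] --> enorm a.
Proof.
move=> e0 ecvg acvg; apply/cvgrPdist_le => e e_gt0.
have /cvgrPdist_le/(_ _ e_gt0) :
    (enorm (a - a_ k) + e_ k) @[k --> \oo] --> (0 : R).
  by rewrite -[0]addr0; exact: cvgD.
apply: filterS => k; rewrite sub0r normrN ger0_norm ?addr_ge0 ?enorm_ge0//.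
apply: le_trans.
have := ler_dist_enorm a (a_ k).
have := smooth_enorm_le (a_ k) (e0 k).
have := smooth_enorm_ge (e_ k) (a_ k).
by rewrite !ler_norml => ? ? /andP[? ?]; apply/andP; split; lra.
Qed.

Lemma ereal_gt0_witness (x : \bar R) : (0 < x)%E ->
  exists2 r : R, 0 < r & (r%:E < x)%E.
Proof.
case: x => [x| |]//; rewrite ?lte_fin => x0; last by exists 1; rewrite ?ltry.
by exists (x / 2); rewrite ?lte_fin; lra.
Qed.

(** Each competitor [smooth_enorm (phi k) *: e] gives
    [A |v_k|^p + defect_k <= [phi_k]^p], whose right-hand side tends to
    [A |u|^p] while both terms on the left are lower semicontinuous. *)
Lemma minimizer_defect_eq0 (u : V -> 'rV[R]_N) : (0 < N)%N ->
  minimizer s p Omega u ->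
  (\int[(leb \x leb)%E]_z
    (gagliardo_defect u (fun x => enorm (u x)) z)%:E = 0)%E.
Proof.
move=> N0 [s0u ntu uL].
have [[meas_u fu] _] := s0u.
have fin_u := sobolev0_pmass_fin p1 oOmega s0u.
have pos_u := sobolev0_pmass_gt0 p1 oOmega s0u ntu.
have [Mf Gf] : (pmass p setT u < +oo /\ gagliardo s p u < +oo)%E.
  by move: fu; rewrite sobolev_norm_lty// => /andP.
pose m := fine (pmass p Omega u).
have mE : pmass p Omega u = m%:E by rewrite fineK.
have m0 : 0 < m by rewrite -lte_fin -mE.
(* Minkowski's inequality compares p-th powers, so the finite quantities
   attached to [u] are written as such. *)
have root (x : \bar R) : (0 <= x)%E -> (x < +oo)%E ->
    exists2 r : R, 0 <= r & x = (r `^ p)%:E.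
  case: x => [x|//|//]; rewrite lee_fin => x0 _; exists (x `^ p^-1).
    exact: powR_ge0.
  by rewrite -powRrM mulVf ?powRr1// gt_eqF.
have [g g0 gE] := root _ (gagliardo_ge0 s p u) Gf.
have [b b0 bE] := root _ (pmass_ge0 p setT u) Mf.
pose A := g `^ p / m.
have A0 : 0 <= A by rewrite divr_ge0 ?powR_ge0// ltW.
have LA : Lambda N s p Omega = A%:E.
  by rewrite -uL /rayleigh -/(pmass p Omega u) gE mE inver gt_eqF.
have [phi [tphi phie phiu]] := sobolev0_approx p1 s0u.
pose eps k : R := 2^-1 ^+ k.
have eps0 k : 0 < eps k by rewrite exprn_gt0// invr_gt0.
have eps_cvg : eps @ \oo --> 0.
  by apply: cvg_expr; rewrite ger0_norm ?invr_ge0// invf_lt1 ?ltr1n.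
have [e e1] : exists e : 'rV[R]_N, enorm e = 1.
  exists (delta_mx ord0 (Ordinal N0)); rewrite /enorm (bigD1 (Ordinal N0))//=.
  rewrite mxE !eqxx/= expr1n big1 ?addr0 ?sqrtr1// => i /negPf iN.
  by rewrite mxE eqxx iN/= expr0n.
pose f k x := smooth_enorm (eps k) (phi k x).
pose v k x := f k x *: e.
have tv k : test_function Omega (v k) by exact: test_function_smooth_enorm.
have mv k := measurable_test_function (tv k).
have mphi k := measurable_test_function (tphi k).
have mf k : measurable_fun setT (f k).
  apply: measurable_funB => //.
  rewrite (_ : (fun x => _) =
    fun x => (eps k ^+ 2 + enorm (phi k x) ^+ 2) `^ 2^-1).
    apply: measurable_powR_comp; apply: measurable_funD => //.
    by apply: measurable_funX; exact: measurable_enorm_comp.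
  by apply/funext => x; rewrite powR12_sqrt// addr_ge0 ?sqr_ge0.
have ve k x : enorm (v k x) = f k x.
  by rewrite enormZ e1 mulr1 ger0_norm// smooth_enorm_ge0// ltW.
have fphi k x y : `|f k x - f k y| <= enorm (phi k x - phi k y).
  exact: le_trans (smooth_enorm_dist _ _ _) (ler_dist_enorm _ _).
have vphi k x : enorm (v k x) <= enorm (phi k x).
  by rewrite ve smooth_enorm_le// ltW.
have dvphi k x y : enorm (v k x - v k y) <= enorm (phi k x - phi k y).
  by rewrite -scalerBl enormZ e1 mulr1.
have Gphi k : (gagliardo s p (phi k) <= ((g + eps k) `^ p)%:E)%E.
  apply: (gagliardo_minkowski p1 meas_u (mphi k) g0 (ltW (eps0 k))); rewrite ?gE//.
  exact: (gagliardo_le_sobolev p1 (ltW (eps0 k)) (phie k)).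
have Mphi k : (pmass p setT (phi k) <= ((b + eps k) `^ p)%:E)%E.
  apply: (pmass_minkowski p1 meas_u (mphi k) b0 (ltW (eps0 k))); rewrite ?bE//.
  exact: (pmass_le_sobolev p1 (ltW (eps0 k)) (phie k)).
have s0v k : sobolev0 s p Omega (v k).
  apply: (test_function_sobolev0 p1 (tv k)); rewrite (sobolev_norm_lty s p1).
  apply/andP; split.
    apply: le_lt_trans (ltry ((b + eps k) `^ p)).
    exact: le_trans (le_pmass p1 (mphi k) (mv k) (vphi k)) (Mphi k).
  apply: le_lt_trans (ltry ((g + eps k) `^ p)).
  exact: le_trans (le_gagliardo s p1 (mphi k) (mv k) (dvphi k)) (Gphi k).
pose D k := (\int[(leb \x leb)%E]_z (gagliardo_defect (phi k) (f k) z)%:E)%E.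
have key k : (A%:E * pmass p Omega (v k) + D k <= ((g + eps k) `^ p)%:E)%E.
  apply: le_trans (Gphi k).
  rewrite (gagliardo_defectE e1 (mphi k) (mf k) (mv k) (fphi k)).
  exact: (leeD (Lambda_pmass_le p1 oOmega LA (s0v k)) (lexx _)).
have f_cvg : {ae leb, forall x, f ^~ x @ \oo --> enorm (u x)}.
  by apply: filterS phiu => x; apply: smooth_enorm_cvg => // k; exact: ltW.
have v_cvg : {ae leb, forall x,
    (fun k => enorm (v k x) `^ p) @ \oo --> enorm (u x) `^ p}.
  apply: filterS f_cvg => x fx; apply: cvg_powR_ge0 => //; rewrite ?enorm_ge0//.
    by move=> k; exact: enorm_ge0.
  by under eq_fun do rewrite ve.
have D_cvg : {ae (leb \x leb)%E, forall z,
    (fun k => gagliardo_defect (phi k) (f k) z) @ \oo -->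
    gagliardo_defect u (fun x => enorm (u x)) z}.
  have both : {ae leb, forall x, (enorm (u x - phi k x) @[k --> \oo] --> 0) /\
      (f ^~ x @ \oo --> enorm (u x))}.
    by apply: filterS2 phiu f_cvg.
  apply: filterS (ae_prod both) => z [[phi1 f1] [phi2 f2]].
  exact: (@gagliardo_defect_cvg phi f u (fun x => enorm (u x))).
have meas_enorm_u : measurable_fun setT (fun x => enorm (u x)) by exact: measurable_enorm_comp.
have defect0 z : 0 <= gagliardo_defect u (fun x => enorm (u x)) z.
  by rewrite gagliardo_defect_ge0// ler_dist_enorm.
apply/eqP; rewrite eq_le; apply/andP; split; last first.
  by apply: integral_ge0 => z _; rewrite lee_fin.
rewrite leNgt; apply/negP => /ereal_gt0_witness[eta eta0 eta_lt].
(* A loss of [delta] in the mass costs [A * delta < eta], less than what a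
   positive defect contributes. *)
pose delta := eta / (2 * (A + 1)).
have delta0 : 0 < delta by rewrite divr_gt0// mulr_gt0// ltr_wpDl.
have Adelta : A * delta < eta.
  rewrite /delta mulrA ltr_pdivrMr ?mulr_gt0 ?ltr_wpDl//; nra.
have Dlarge : \forall k \near \oo, (eta%:E < D k)%E.
  apply: fatou_lt eta_lt => //.
  - by move=> k; exact: measurable_gagliardo_defect.
  - exact: measurable_gagliardo_defect.
  - by move=> k z; exact: gagliardo_defect_ge0.
have Mlarge : \forall k \near \oo, ((m - delta)%:E < pmass p Omega (v k))%E.
  apply: (@fatou_lt _ _ _ leb Omega (fun k x => enorm (v k x) `^ p)
    (fun x => enorm (u x) `^ p)) => //.
  - by move=> k; exact: measurable_enorm_powR.
  - exact: measurable_enorm_powR.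
  - by move=> k x; exact: powR_ge0.
  - by move=> x; exact: powR_ge0.
  - rewrite [X in (_ < X)%E](_ : _ = m%:E); last exact: mE.
    by rewrite lte_fin ltrBlDr ltrDl.
have : A * (m - delta) + eta <= g `^ p.
  have gcvg : (fun k => (g + eps k) `^ p) @ \oo --> g `^ p.
    apply: cvg_powR_ge0 => // [k|]; first by rewrite addr_ge0// ltW.
    by rewrite -[X in _ --> X]addr0; apply: cvgD => //; exact: cvg_cst.
  rewrite -(cvg_lim (@Rhausdorff R) gcvg); apply: limr_ge.
    by apply/cvg_ex; exists (g `^ p).
  apply: filterS2 Dlarge Mlarge => k /ltW Dk /ltW Mk.
  rewrite -lee_fin; apply: le_trans (key k).
  rewrite EFinD EFinM; apply: leeD Dk.
  by apply: lee_wpmul2l Mk; rewrite lee_fin.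
have -> : g `^ p = A * m by rewrite /A divfK// gt_eqF.
by rewrite mulrBr; lra.
Qed.

End minimizers.

Section proportionality.
Variables (R : realType) (n N : nat) (s p : R) (Omega : set 'rV[R]_n).
Hypotheses (p1 : 1 < p) (oOmega : open Omega).
Local Notation V := 'rV[R]_n.
Local Notation leb := (lebesgue_rV R n).

Let p0 : 0 < p. Proof. exact: lt_trans ltr01 p1. Qed.

Lemma rayleighE M (v : V -> 'rV[R]_M) :
  rayleigh s p Omega v = (gagliardo s p v / pmass p Omega v)%E.
Proof. by []. Qed.

(** The defect vanishes almost everywhere; off the diagonal the weight can be
    cancelled, and on the diagonal there is nothing to prove. *)
Lemma minimizer_ae_parallel (u : V -> 'rV[R]_N) : (0 < N)%N ->
  minimizer s p Omega u ->
  {ae leb, forall x, {ae leb, forall y,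
    enorm (u y) *: u x = enorm (u x) *: u y}}.
Proof.
move=> N0 mu; have [[[meas_u _] _] _ _] := mu.
have meas_enorm : measurable_fun setT (fun x => enorm (u x)).
  exact: measurable_enorm_comp.
have defect0 z : 0 <= gagliardo_defect s p u (fun x => enorm (u x)) z.
  by rewrite gagliardo_defect_ge0// ler_dist_enorm.
have := ge0_integral_prod_eq0 (measurable_gagliardo_defect s p meas_u meas_enorm)
  defect0 (minimizer_defect_eq0 p1 oOmega N0 mu).
apply: filterS => x; apply: filterS => y /=.
rewrite /gagliardo_defect /= => /eqP; rewrite subr_eq0 => /eqP h.
have [->//|xy] := eqVneq x y.
apply: enormB_dist_parallel.
have w0 := gagliardo_weight_gt0 s p xy.
apply: (mulIf (lt0r_neq0 w0)); apply: (powR_injective p0) h.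
- by rewrite nnegrE mulr_ge0 ?enorm_ge0// ltW.
- by rewrite nnegrE mulr_ge0// ltW.
Qed.

(** One base point with a nonzero value determines the direction of almost all
    other values; it exists because [u] does not vanish almost everywhere. *)
Lemma minimizer_ae_ray (u : V -> 'rV[R]_N) : (0 < N)%N ->
  minimizer s p Omega u ->
  exists2 c : 'rV[R]_N, enorm c = 1 & {ae leb, forall x, u x = enorm (u x) *: c}.
Proof.
move=> N0 mu; have [_ ntu _] := mu.
have par := minimizer_ae_parallel N0 mu.
have [x0 [ux0 parx0]] : exists x, u x <> 0 /\
    {ae leb, forall y, enorm (u y) *: u x = enorm (u x) *: u y}.
  apply: contrapT => none; apply: ntu; apply: filterS par => x parx.
  by apply: contrapT => ux; apply: none; exists x.
have e0 : enorm (u x0) != 0 by apply/eqP => /enorm_eq0.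
exists ((enorm (u x0))^-1 *: u x0).
  by rewrite enormZ ger0_norm ?invr_ge0 ?enorm_ge0// mulVf.
apply: filterS parx0 => y pary.
by rewrite scalerA mulrC -scalerA pary scalerA mulVf// scale1r.
Qed.

(** A unit vector turns scalar competitors into vector ones without changing
    any of the integrals. *)
Lemma Lambda_vector_le_scalar (c : 'rV[R]_N) : enorm c = 1 ->
  (Lambda N s p Omega <= Lambda 1 s p Omega)%E.
Proof.
move=> c1.
have cE (a : 'rV[R]_1) : enorm (a *m c) = enorm a.
  rewrite [a in LHS]mx11_scalar mul_scalar_mx enormZ c1 mulr1.
  by rewrite enorm_rV1.
apply: le_ereal_inf_tmp => _ [v [s0v ntv] <-].
have Gc : gagliardo s p v = gagliardo s p (fun x => v x *m c).
  apply: eq_integral => x _; apply: eq_integral => y _.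
  by rewrite -mulmxBl cE.
have Mc : pmass p Omega v = pmass p Omega (fun x => v x *m c).
  by apply: eq_integral => x _; rewrite cE.
rewrite (rayleighE v) Gc Mc -rayleighE.
apply: Lambda_le_rayleigh.
  by apply: (sobolev0_mulmx p1 _ s0v) => a; rewrite cE.
move=> vc0; apply: ntv; apply: filterS vc0 => x vcx.
by apply: enorm_eq0; rewrite -cE vcx enorm0.
Qed.

End proportionality.

Theorem theorem4p2 (R : realType) (n N : nat) (s p : R) (Omega : set 'rV[R]_n)
    (u : 'rV[R]_n -> 'rV[R]_N) :
  (0 < n)%N -> (0 < N)%N -> 0 < s < 1 -> 1 < p ->
  bounded_domain Omega ->
  minimizer s p Omega u ->
  exists (c : 'rV[R]_N) (w : 'rV[R]_n -> R),
    [/\ c != 0,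
        minimizer s p Omega (fun x => (w x)%:M : 'rV[R]_1) &
        {ae lebesgue_rV R n, forall x, u x = w x *: c}].
Proof.
move=> _ N0 _ p1 [_ oOmega _ _] mu.
have [s0u ntu uL] := mu; have [[meas_u _] _] := s0u.
have [c c1 uc] := minimizer_ae_ray p1 oOmega N0 mu.
pose w x := dotv (u x) c.
have wE : (fun x => (w x)%:M : 'rV[R]_1) = fun x => u x *m c^T.
  apply/funext => x; rewrite [RHS]mx11_scalar; congr (_%:M).
  by rewrite mxE; apply: eq_bigr => i _; rewrite mxE.
have cT (a : 'rV[R]_N) : enorm (a *m c^T) <= enorm a.
  rewrite enorm_rV1 (_ : (a *m c^T) _ _ = dotv a c); last first.
    by rewrite mxE; apply: eq_bigr => i _; rewrite mxE.
  rewrite ler_norml; have := dotv_le a c; have := dotv_le (-1 *: a) c.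
  rewrite enormZ normrN1 mul1r c1 mulr1.
  rewrite (_ : dotv (-1 *: a) c = - dotv a c); last first.
    by rewrite /dotv -sumrN; apply: eq_bigr => i _; rewrite mxE mulN1r mulNr.
  by move=> ? ?; apply/andP; split; lra.
have uw : {ae lebesgue_rV R n, forall x, u x = w x *: c}.
  apply: filterS uc => x ux; rewrite {1}ux; congr (_ *: _).
  rewrite /w {2}ux /dotv.
  under eq_bigr do rewrite mxE -mulrA.
  by rewrite -mulr_sumr -[X in _ * X]/(dotv c c) -sqr_enorm c1 expr1n mulr1.
exists c, w; split=> //.
  by apply/eqP => c0; move: c1; rewrite c0 enorm0 => /esym/eqP; rewrite oner_eq0.
have s0w : sobolev0 s p Omega (fun x => (w x)%:M : 'rV[R]_1).
  by rewrite wE; exact: (sobolev0_mulmx p1 cT s0u).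
have [[meas_w _] _] := s0w.
have ntw : nontrivial (fun x => (w x)%:M : 'rV[R]_1).
  move=> w0; apply: ntu; apply: filterS2 uw w0 => x -> /matrixP/(_ ord0 ord0).
  by rewrite !mxE eqxx mulr1n => ->; rewrite scale0r.
have wM x y : enorm ((w x)%:M - (w y)%:M : 'rV[R]_1) = enorm (w x *: c - w y *: c).
  by rewrite -scalerBl enormZ c1 mulr1 enorm_rV1 !mxE eqxx !mulr1n.
have Gw : gagliardo s p (fun x => (w x)%:M : 'rV[R]_1) = gagliardo s p u.
  rewrite (gagliardoE s p1 meas_w) (gagliardoE s p1 meas_u).
  apply: ge0_ae_eq_integral => //.
  - by apply/measurable_EFinP; exact: measurable_difference_quotient_powR.
  - by apply/measurable_EFinP; exact: measurable_difference_quotient_powR.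
  - by move=> z _; rewrite lee_fin powR_ge0.
  - by move=> z _; rewrite lee_fin powR_ge0.
  apply: filterS (ae_prod uw) => z [u1 u2] _.
  by rewrite /difference_quotient wM -u1 -u2.
have Mw : pmass p Omega (fun x => (w x)%:M : 'rV[R]_1) = pmass p Omega u.
  apply: ge0_ae_eq_integral.
  - exact: open_measurable_rV.
  - apply: measurable_funTS.
    by apply/measurable_EFinP; exact: measurable_enorm_powR.
  - apply: measurable_funTS.
    by apply/measurable_EFinP; exact: measurable_enorm_powR.
  - by move=> x _; rewrite lee_fin powR_ge0.
  - by move=> x _; rewrite lee_fin powR_ge0.
  apply: filterS uw => x ux _.
  by rewrite ux enormZ c1 mulr1 enorm_rV1 mxE eqxx mulr1n.
have ruw : rayleigh s p Omega (fun x => (w x)%:M : 'rV[R]_1) = rayleigh s p Omega u.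
  by rewrite rayleighE Gw Mw.
split; [exact: s0w|exact: ntw|].
apply/eqP; rewrite eq_le; apply/andP; split.
  by rewrite ruw uL; exact: (Lambda_vector_le_scalar s Omega p1 c1).
exact: (Lambda_le_rayleigh s0w ntw).
Qed.
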